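(* Let $a<b$ and $c<d$ be real numbers, let $\Delta=[a,b]\times[c,d]$, let $g:\Delta\to\mathbb{R}$ be convex on the co-ordinates on $\Delta$, and let $f:\Delta\to\mathbb{R}$ be $g$-convex dominated on the co-ordinates. Then $$\left|\frac{1}{(b-a)(d-c)}\int_a^b\int_c^d f(x,y)\,dy\,dx-f\left(\frac{a+b}{2},\frac{c+d}{2}\right)\right|\le \frac{1}{(b-a)(d-c)}\int_a^b\int_c^d g(x,y)\,dy\,dx-g\left(\frac{a+b}{2},\frac{c+d}{2}\right)$$ and $$\left|\frac{f(a,c)+f(a,d)+f(b,c)+f(b,d)}{4}-\frac{1}{(b-a)(d-c)}\int_a^b\int_c^d f(x,y)\,dy\,dx\right|$$ $$\le \frac{g(a,c)+g(a,d)+g(b,c)+g(b,d)}{4}-\frac{1}{(b-a)(d-c)}\int_a^b\int_c^d g(x,y)\,dy\,dx.$$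
   Context: One variable: if $I\subseteq\mathbb{R}$ is an interval and $k:I\to\mathbb{R}$ is convex, a function $h:I\to\mathbb{R}$ is called $k$-convex dominated on $I$ if $$|\lambda h(u)+(1-\lambda)h(w)-h(\lambda u+(1-\lambda)w)|\le \lambda k(u)+(1-\lambda)k(w)-k(\lambda u+(1-\lambda)w)$$ for all $u,w\in I$, $\lambda\in[0,1]$. For a function $\varphi:\Delta=[a,b]\times[c,d]\to\mathbb{R}$, its partial mappings are $\varphi_x:[c,d]\to\mathbb{R}$, $\varphi_x(u)=\varphi(x,u)$ (for $x\in[a,b]$) and $\varphi_y:[a,b]\to\mathbb{R}$, $\varphi_y(w)=\varphi(w,y)$ (for $y\in[c,d]$). The function $\varphi$ is convex on the co-ordinates on $\Delta$ if all the partial mappings $\varphi_x$ ($x\in[a,b]$) and $\varphi_y$ ($y\in[c,d]$) are convex. Given $g:\Delta\to\mathbb{R}$ convex on the co-ordinates, $f:\Delta\to\mathbb{R}$ is $g$-convex dominated on the co-ordinates if $f_x$ is $g_x$-convex dominated on $[c,d]$ for every $x\in[a,b]$ and $f_y$ is $g_y$-convex dominated on $[a,b]$ for every $y\in[c,d]$. *)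

(* Defs.v *)
From HB Require Import structures.
From mathcomp Require Import all_boot all_order all_algebra.
From mathcomp Require Import all_classical all_reals all_analysis.

Set Implicit Arguments.
Unset Strict Implicit.
Unset Printing Implicit Defensive.

Import Order.TTheory GRing.Theory Num.Theory.
Import numFieldNormedType.Exports.

Local Open Scope classical_set_scope.
Local Open Scope ring_scope.

(* Functions on an interval I (resp. a rectangle I x J) are represented by
   total functions on R (resp. on R and R, curried); every condition below
   only constrains their values on I (resp. I x J). *)

(* The convexity of k on I is not part of this predicate: it is a standing
   assumption on k, to be supplied separately. *)
Definition convex_dominated (R : realType) (I : interval R) (k h : R -> R) :=
  forall u w t : R, u \in I -> w \in I -> 0 <= t <= 1 ->
    `|t * h u + (1 - t) * h w - h (t * u + (1 - t) * w)|
      <= t * k u + (1 - t) * k w - k (t * u + (1 - t) * w).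

Definition coord_convex (R : realType) (I J : interval R)
    (phi : R -> R -> R) :=
  (forall x, x \in I -> convex_function (E := R^o) [set` J] (fun u => phi x u))
  /\ (forall y, y \in J ->
        convex_function (E := R^o) [set` I] (fun w => phi w y)).

Definition coord_convex_dominated (R : realType) (I J : interval R)
    (g f : R -> R -> R) :=
  (forall x, x \in I ->
     convex_dominated J (fun u => g x u) (fun u => f x u))
  /\ (forall y, y \in J ->
        convex_dominated I (fun w => g w y) (fun w => f w y)).

(* Main.v *)
(** A function [f] is [g]-convex dominated exactly when [g + f] and [g - f] are
    convex, and both inequalities for [f] and [g] together say that the
    Hermite-Hadamard inequalities hold for the coordinate-convex functions
    [g + f] and [g - f].  For a coordinate-convex [p], the inner integral
    [x |-> \int_c^d p x y dy] is again convex, so these follow by applying the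
    one-variable inequality first in [x] and then in [y].  The latter comes from
    integrating the chord (above) and a supporting line at the midpoint
    (below). *)
Require Import Defs.
From HB Require Import structures.
From mathcomp Require Import all_boot all_order all_algebra.
From mathcomp Require Import all_classical all_reals all_analysis.
From mathcomp Require Import measurable_realfun ring lra.

Set Implicit Arguments.
Unset Strict Implicit.
Unset Printing Implicit Defensive.

Import Order.TTheory GRing.Theory Num.Theory.
Import numFieldNormedType.Exports.

Local Open Scope classical_set_scope.
Local Open Scope ring_scope.

(** * Convexity on an interval, measurability and integrability *)

(** Explicit real weights, as in [convex_dominated], let domination and convexity be compared by
    linear arithmetic. *)
Definition convex_on (R : realType) (I : interval R) (k : R -> R) :=
  forall u w t : R, u \in I -> w \in I -> 0 <= t <= 1 ->
    k (t * u + (1 - t) * w) <= t * k u + (1 - t) * k w.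

Section ConvexOnSegment.
Context (R : realType).
Implicit Types (a b : R) (h k : R -> R) (I : interval R).

Local Notation mu := (@lebesgue_measure R).

Lemma convex_on_dominated I h k : convex_dominated I k h ->
  convex_on I (fun x => k x + h x) /\ convex_on I (fun x => k x - h x).
Proof.
by move=> hk; split=> u w t uI wI t01; have := hk u w t uI wI t01;
  rewrite ler_norml => /andP[]; lra.
Qed.

Lemma between_conv (u z w : R) : u <= z <= w ->
  exists2 t, 0 <= t <= 1 & z = t * u + (1 - t) * w.
Proof.
move=> /andP[uz zw]; have [uw|uw] := eqVneq u w.
  by exists 0; [rewrite lexx ler01 | lra].
have wu : 0 < w - u by rewrite subr_gt0 lt_neqAle uw (le_trans uz).
exists ((w - z) / (w - u)); last by field; rewrite gt_eqF.
by rewrite divr_ge0 ?ler_pdivrMr//=; lra.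
Qed.

(** Clearing the denominator [w - u] keeps the degenerate case [u = w] valid. *)
Lemma convex_on_three_points I k u z w : convex_on I k ->
  u \in I -> w \in I -> u <= z <= w ->
  (w - u) * k z <= (w - z) * k u + (z - u) * k w.
Proof.
move=> ck uI wI uzw; have [t t01 zE] := between_conv uzw.
have wu : 0 <= w - u by move: uzw => /andP[]; lra.
have := ler_wpM2l wu (ck u w t uI wI t01); rewrite -zE.
by move=> /le_trans; apply; rewrite zE le_eqVlt; apply/orP; left; apply/eqP; ring.
Qed.

(* The sublevel sets of a convex function are intervals. *)
Lemma convex_on_measurable a b k : convex_on `[a, b] k ->
  measurable_fun `[a, b] k.
Proof.
move=> ck mD; apply: (measurability _ (RGenInftyO.measurableE R)) => //.
move=> _ [_ [r ->] <-]; apply: is_interval_measurable => u w /=.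
rewrite !in_itv/= => -[uD ur] [wD wr] z uzw.
have [t t01 zE] := between_conv uzw; rewrite in_itv/=; split.
  by move: uD wD uzw => /andP[? ?] /andP[? ?] /andP[? ?]; apply/andP; split; lra.
rewrite zE; apply: (le_lt_trans (ck u w t _ _ t01)); rewrite ?in_itv//.
(* A convex combination is at most the larger of [k u] and [k w], and both are below [r]. *)
have /andP[t0 t1] := t01; have [kuw|kwu] := leP (k u) (k w).
  by apply: le_lt_trans wr; nra.
by apply: le_lt_trans ur; nra.
Qed.

(** Convexity allows jumps at the endpoints, so integrability comes from measurability and
    boundedness rather than continuity. *)
Lemma convex_on_integrable a b k : a < b -> convex_on `[a, b] k ->
  mu.-integrable `[a, b] (EFin \o k).
Proof.
move=> ab ck.
have fD : (mu `[a, b] < +oo)%E.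
  by rewrite lebesgue_measure_itv/= lte_fin ab -EFinB ltry.
apply: measurable_bounded_integrable => //=; first exact: (convex_on_measurable ck).
set m := k ((a + b) / 2).
(* The first two terms bound [k] from above, since convexity puts it below its chord. The last
   enters through the lower bound [2 * m - k (a + b - x)]. *)
exists (`|k a| + `|k b| + 2 * `|m|); split; first exact: num_real.
move=> M HM x /=; rewrite in_itv/= => /andP[ax xb].
have aI : a \in `[a, b] by rewrite in_itv/= lexx ltW.
have bI : b \in `[a, b] by rewrite in_itv/= lexx ltW.
have ub y : a <= y <= b -> k y <= `|k a| + `|k b|.
  move=> /between_conv[t t01 ->]; apply: (le_trans (ck a b t aI bI t01)).
  move: t01 => /andP[t0 t1].
  have := ler_norm (k a); have := ler_norm (k b).
  have := normr_ge0 (k a); have := normr_ge0 (k b); nra.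
(* Lower bound: [2 m <= k x + k (a + b - x)], and [k] is bounded above. *)
have h2 : 0 <= (2^-1 : R) <= 1 by apply/andP; split; lra.
have xI : x \in `[a, b] by rewrite in_itv/= ax.
have yI : a + b - x \in `[a, b] by rewrite in_itv/=; apply/andP; split; lra.
have := ck _ _ _ xI yI h2.
rewrite (_ : 2^-1 * x + _ = (a + b) / 2); last by field.
rewrite -/m => lb; have := ub x; rewrite ax xb => /(_ isT) ux.
have := ub (a + b - x); move: (yI); rewrite in_itv/= => -> /(_ isT) uy.
apply/ltW/(le_lt_trans _ HM).
have := ler_norm (- m); rewrite normrN => nm; have := normr_ge0 m => m0.
by rewrite ler_norml; apply/andP; split; lra.
Qed.

(** * Integrals of affine functions over a segment *)

Lemma Rintegral_segment_cst a b r : a < b ->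
  \int[mu]_(x in `[a, b]) r = r * (b - a).
Proof. by move=> ab; rewrite Rintegral_cst//= lebesgue_measure_itv/= lte_fin ab. Qed.

(** Affine functions satisfy the convexity inequality with equality. Centring at the midpoint makes
    the slope term integrate to zero. *)
Lemma integrable_segment_affine a b r s : a < b ->
  mu.-integrable `[a, b] (EFin \o (fun x => r + s * (x - (a + b) / 2))).
Proof.
move=> ab; apply: convex_on_integrable => // u w t _ _ _.
by rewrite le_eqVlt; apply/orP; left; apply/eqP; ring.
Qed.

Lemma Rintegral_segment_centered a b : a < b ->
  \int[mu]_(x in `[a, b]) (x - (a + b) / 2) = 0.
Proof.
move=> ab; set m := (a + b) / 2.
(* An antiderivative symmetric about [m], hence equal at [a] and [b]. *)
pose F (y : R) := 2^-1 * (y - m) ^+ 2.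
have dF (x : R) : is_derive x 1 F (x - m).
  by apply: is_derive_eq; rewrite /GRing.scale/=; field.
have derF (x : R) : derivable F x 1 by exact: (@ex_derive _ _ _ _ _ _ _ (dF x)).
have cF : continuous F.
  by move=> x; apply/differentiable_continuous/derivable1_diffP.
transitivity (fine ((F b)%:E - (F a)%:E)); last by rewrite /F /m /=; field.
congr fine; apply: continuous_FTC2 => //.
- by apply: continuous_subspaceT => x; apply: cvgB; [exact: cvg_id|exact: cvg_cst].
- by split=> //; [exact/cvg_at_right_filter/cF|exact/cvg_at_left_filter/cF].
- by move=> x _; rewrite derive1E; exact: (@derive_val _ _ _ _ _ _ _ (dF x)).
Qed.

Lemma Rintegral_segment_affine a b r s : a < b ->
  \int[mu]_(x in `[a, b]) (r + s * (x - (a + b) / 2)) = r * (b - a).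
Proof.
move=> ab.
have ic : mu.-integrable `[a, b] (EFin \o (fun=> r)).
  apply: eq_integrable (integrable_segment_affine r 0 ab) => //= x _.
  by rewrite mul0r addr0.
have ix s' : mu.-integrable `[a, b] (EFin \o (fun x => s' * (x - (a + b) / 2))).
  apply: eq_integrable (integrable_segment_affine 0 s' ab) => //= x _.
  by rewrite add0r.
rewrite RintegralD// Rintegral_segment_cst// RintegralZl//; last first.
  by apply: eq_integrable (ix 1) => //= x _; rewrite mul1r.
by rewrite Rintegral_segment_centered// mulr0 addr0.
Qed.

(** * Supporting lines and the one-variable inequality *)

(** Chord slopes to the left of [z] never exceed those to the right, so the supremum of the left
    slopes separates the two families and serves as [s]. *)
Lemma convex_on_supporting_line a b k z : a < z < b -> convex_on `[a, b] k ->
  exists s, forall x, a <= x <= b -> k z + s * (x - z) <= k x.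
Proof.
move=> /andP[az zb] ck.
pose slope u := (k z - k u) / (z - u).
pose S := [set slope u | u in `[a, z[].
have slopes u w : a <= u < z -> z < w <= b -> slope u <= (k w - k z) / (w - z).
  move=> /andP[au uz] /andP[zw wb].
  rewrite /slope ler_pdivrMr ?subr_gt0// mulrAC ler_pdivlMr ?subr_gt0//.
  have : (w - u) * k z <= (w - z) * k u + (z - u) * k w.
    by apply: convex_on_three_points ck _ _ _; rewrite ?in_itv/=;
      apply/andP; split; lra.
  lra.
have S0 : S (slope a) by exists a => //=; rewrite in_itv/= lexx.
have Sub w : z < w <= b -> ubound S ((k w - k z) / (w - z)).
  by move=> zw _ [u /= uI <-]; apply: slopes => //; move: uI; rewrite in_itv.
have hS : has_sup S.
  split; first by exists (slope a).
  by exists ((k b - k z) / (b - z)); apply: Sub; rewrite zb lexx.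
exists (sup S) => x /andP[ax xb]; have [xz|zx|->] := ltgtP x z.
- have : slope x <= sup S.
    by apply: ub_le_sup; [case: hS|exists x => //=; rewrite in_itv/= ax].
  rewrite ler_pdivrMr ?subr_gt0//; lra.
- have : sup S <= (k x - k z) / (x - z).
    by apply: ge_sup; [case: hS|apply: Sub; rewrite zx].
  rewrite ler_pdivlMr ?subr_gt0//; lra.
- by rewrite subrr mulr0 addr0.
Qed.

Lemma hermite_hadamard a b k : a < b -> convex_on `[a, b] k ->
  k ((a + b) / 2) * (b - a) <= \int[mu]_(x in `[a, b]) k x
    <= (k a + k b) / 2 * (b - a).
Proof.
move=> ab ck; apply/andP; split.
  have [|s hs] := @convex_on_supporting_line a b k ((a + b) / 2) _ ck.
    by apply/andP; split; lra.
  rewrite -(Rintegral_segment_affine _ s)//; apply: le_Rintegral => //.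
  - exact: integrable_segment_affine.
  - exact: convex_on_integrable.
(* The chord in centred form has midpoint height [(k a + k b) / 2]. *)
rewrite -(Rintegral_segment_affine _ ((k b - k a) / (b - a)))//.
apply: le_Rintegral => //; first exact: convex_on_integrable.
  exact: integrable_segment_affine.
move=> x /=; rewrite in_itv/= => xab.
have ba : 0 < b - a by lra.
rewrite -(ler_pM2l ba).
have aI : a \in `[a, b] by rewrite in_itv/= lexx ltW.
have bI : b \in `[a, b] by rewrite in_itv/= lexx ltW.
apply: (le_trans (convex_on_three_points ck aI bI xab)).
by rewrite le_eqVlt; apply/orP; left; apply/eqP; field; rewrite gt_eqF.
Qed.

End ConvexOnSegment.

(** * Iterated integrals of coordinate-convex functions *)

Section DoubleIntegral.
Context (R : realType) (a b c d : R).
Implicit Types p : R -> R -> R.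

Local Notation mu := (@lebesgue_measure R).

(** Convexity in [x] is integrated over [y] by monotonicity and linearity; convexity in [y] makes
    each slice integrable. *)
Lemma convex_on_Rintegral p : c < d ->
  (forall x, x \in `[a, b] -> convex_on `[c, d] (p x)) ->
  (forall y, y \in `[c, d] -> convex_on `[a, b] (p ^~ y)) ->
  convex_on `[a, b] (fun x => \int[mu]_(y in `[c, d]) p x y).
Proof.
move=> cd c1 c2 u w t uI wI t01.
have tI : t * u + (1 - t) * w \in `[a, b].
  move: uI wI t01; rewrite !in_itv/= => /andP[? ?] /andP[? ?] /andP[? ?].
  by apply/andP; split; nra.
have ip x : x \in `[a, b] -> mu.-integrable `[c, d] (EFin \o p x).
  by move=> xI; apply: convex_on_integrable => //; exact: c1.
have iZ r x : x \in `[a, b] ->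
    mu.-integrable `[c, d] (EFin \o (fun y => r * p x y)).
  by move=> xI; apply: eq_integrable (integrableZl _ r (ip x xI)).
rewrite -!RintegralZl//; [|exact: ip..].
rewrite -RintegralD//; [|exact: iZ..].
apply: le_Rintegral => //; first exact: ip.
  by apply: eq_integrable (integrableD _ (iZ t u uI) (iZ (1 - t) w wI)).
by move=> y yI; exact: c2.
Qed.

Lemma hermite_hadamard2 p : a < b -> c < d ->
  (forall x, x \in `[a, b] -> convex_on `[c, d] (p x)) ->
  (forall y, y \in `[c, d] -> convex_on `[a, b] (p ^~ y)) ->
  p ((a + b) / 2) ((c + d) / 2) * ((b - a) * (d - c))
    <= \int[mu]_(x in `[a, b]) \int[mu]_(y in `[c, d]) p x y
    <= (p a c + p a d + p b c + p b d) / 4 * ((b - a) * (d - c)).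
Proof.
move=> ab cd c1 c2.
have [aI bI mI] : [/\ a \in `[a, b], b \in `[a, b] & (a + b) / 2 \in `[a, b]].
  by rewrite !in_itv/=; split; apply/andP; split; lra.
have /andP[lo up] := hermite_hadamard ab (convex_on_Rintegral cd c1 c2).
(* The slice at the midpoint continues the lower bound, the slices at [a] and [b] the upper one. *)
have /andP[lom _] := hermite_hadamard cd (c1 _ mI).
have /andP[_ upa] := hermite_hadamard cd (c1 _ aI).
have /andP[_ upb] := hermite_hadamard cd (c1 _ bI).
have ba : 0 <= b - a by lra.
apply/andP; split.
  apply: le_trans lo; rewrite mulrA mulrAC; exact: ler_wpM2r.
apply: (le_trans up); rewrite mulrA (mulrAC _ (b - a)); apply: ler_wpM2r => //.
lra.
Qed.

End DoubleIntegral.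

(** * Return from the sum and difference to [f] and [g] *)

(** Half the sum and half the difference of the two combinations recover [g] and [f]. This is how
    [f], which need not be convex, becomes integrable. *)
Lemma integrable_addr_subr (R : realType) d (T : measurableType d)
    (mu : {measure set T -> \bar R}) (D : set T) (g f : T -> R) :
  measurable D ->
  mu.-integrable D (EFin \o (fun x => g x + f x)) ->
  mu.-integrable D (EFin \o (fun x => g x - f x)) ->
  mu.-integrable D (EFin \o g) /\ mu.-integrable D (EFin \o f).
Proof.
move=> mD ip im; split.
- apply: eq_integrable (integrableZl mD 2^-1 (integrableD mD ip im)) => //= x _.
  by rewrite -EFinD -EFinM; congr EFin; field.
- apply: eq_integrable (integrableZl mD 2^-1 (integrableB mD ip im)) => //= x _.
  by rewrite -EFinB -EFinM; congr EFin; field.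
Qed.

Theorem theorem5 (R : realType) (a b c d : R) (f g : R -> R -> R)
  (hab : a < b) (hcd : c < d)
  (hg : coord_convex `[a, b] `[c, d] g)
  (hf : coord_convex_dominated `[a, b] `[c, d] g f) :
  `| 1 / ((b - a) * (d - c)) *
       (\int[lebesgue_measure]_(x in `[a, b])
         \int[lebesgue_measure]_(y in `[c, d]) f x y)
     - f ((a + b) / 2) ((c + d) / 2) |
    <= 1 / ((b - a) * (d - c)) *
         (\int[lebesgue_measure]_(x in `[a, b])
           \int[lebesgue_measure]_(y in `[c, d]) g x y)
       - g ((a + b) / 2) ((c + d) / 2)
  /\
  `| (f a c + f a d + f b c + f b d) / 4
     - 1 / ((b - a) * (d - c)) *
         (\int[lebesgue_measure]_(x in `[a, b])
           \int[lebesgue_measure]_(y in `[c, d]) f x y) |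
    <= (g a c + g a d + g b c + g b d) / 4
       - 1 / ((b - a) * (d - c)) *
           (\int[lebesgue_measure]_(x in `[a, b])
             \int[lebesgue_measure]_(y in `[c, d]) g x y).
Proof.
move: hf => [hf1 hf2].
set mu := (@lebesgue_measure R).
set F := fun x => \int[mu]_(y in `[c, d]) f x y.
set G := fun x => \int[mu]_(y in `[c, d]) g x y.
pose p x y := g x y + f x y; pose q x y := g x y - f x y.
have p1 x : x \in `[a, b] -> convex_on `[c, d] (p x).
  by move=> /hf1/convex_on_dominated[].
have q1 x : x \in `[a, b] -> convex_on `[c, d] (q x).
  by move=> /hf1/convex_on_dominated[].
have p2 y : y \in `[c, d] -> convex_on `[a, b] (p ^~ y).
  by move=> /hf2/convex_on_dominated[].
have q2 y : y \in `[c, d] -> convex_on `[a, b] (q ^~ y).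
  by move=> /hf2/convex_on_dominated[].
have ifg x : x \in `[a, b] -> mu.-integrable `[c, d] (EFin \o g x) /\
    mu.-integrable `[c, d] (EFin \o f x).
  by move=> xI; apply: integrable_addr_subr => //; apply: convex_on_integrable;
    [|exact: p1| |exact: q1].
have pE x : x \in `[a, b] -> \int[mu]_(y in `[c, d]) p x y = G x + F x.
  by move=> /ifg[ig if_]; rewrite /p RintegralD.
have qE x : x \in `[a, b] -> \int[mu]_(y in `[c, d]) q x y = G x - F x.
  by move=> /ifg[ig if_]; rewrite /q RintegralB.
(* On [[a, b]] the inner integrals of [p] and [q] are [G + F] and [G - F]; both are convex, hence
   integrable. *)
have [iG iF] : mu.-integrable `[a, b] (EFin \o G) /\
    mu.-integrable `[a, b] (EFin \o F).
  apply: integrable_addr_subr => //.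
  - apply: eq_integrable (convex_on_integrable hab
      (convex_on_Rintegral hcd p1 p2)) => //= x.
    by rewrite inE/= => /pE ->.
  - apply: eq_integrable (convex_on_integrable hab
      (convex_on_Rintegral hcd q1 q2)) => //= x.
    by rewrite inE/= => /qE ->.
have := hermite_hadamard2 hab hcd p1 p2.
have -> : \int[mu]_(x in `[a, b]) \int[mu]_(y in `[c, d]) p x y =
    \int[mu]_(x in `[a, b]) G x + \int[mu]_(x in `[a, b]) F x.
  by rewrite -RintegralD//; apply: eq_Rintegral => x; rewrite inE/= => /pE.
move=> /andP[plo pup].
have := hermite_hadamard2 hab hcd q1 q2.
have -> : \int[mu]_(x in `[a, b]) \int[mu]_(y in `[c, d]) q x y =
    \int[mu]_(x in `[a, b]) G x - \int[mu]_(x in `[a, b]) F x.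
  by rewrite -RintegralB//; apply: eq_Rintegral => x; rewrite inE/= => /qE.
move=> /andP[qlo qup].
set A := (b - a) * (d - c) in plo pup qlo qup *.
have A0 : 0 < A by rewrite mulr_gt0 ?subr_gt0.
(* After division by the area [A], the two lower bounds are the two halves of the first absolute
   value inequality, and the two upper bounds those of the second. *)
move: plo pup qlo qup.
rewrite -!(ler_pdivlMr _ _ A0) -!(ler_pdivrMr _ _ A0) /p /q.
rewrite (mulrDl _ _ A^-1) (mulrBl A^-1) !(mulrC (1 / A)) !mul1r.
by move=> *; rewrite !ler_norml; split; apply/andP; split; lra.
Qed.
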